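(* Let $\Omega$ be a set and let $Q$ index a join-sub-semilattice $\{\mathcal{P}_x : x\in Q\}$ of $(Part(\Omega),\leq)$ that contains the top partition $\mathcal{P}_\top$ into singletons. Then $\Phi(\Omega)$, with combination $\cdot$, the relation $x\bot y\vert z$ on $Q$, and the extraction operators $\epsilon_x$ ($x\in Q$), is a domain-free information algebra, i.e.: 1. (Semigroup) $(\Phi,\cdot)$ is a commutative semigroup with null element $0=\mathcal{L}(\Omega)$ and unit element $1=\mathcal{L}^+(\Omega)$. 2. (Quasi-separoid) $(Q,\leq)$ is a join semilattice and for all $x,y,z,w\in Q$: $x\bot y\vert y$; $x\bot y\vert z$ implies $y\bot x\vert z$; $x\bot y\vert z$ and $w\leq y$ imply $x\bot w\vert z$; $x\bot y\vert z$ implies $x\bot (y\vee z)\vert z$. 3. (Existential quantifier) For all $x\in Q$ and $\mathcal{D},\mathcal{D}_1,\mathcal{D}_2\in\Phi$: (a) $\epsilon_x(0)=0$; (b) $\epsilon_x(\mathcal{D})\cdot\mathcal{D}=\mathcal{D}$; (c) $\epsilon_x(\epsilon_x(\mathcal{D}_1)\cdot\mathcal{D}_2)=\epsilon_x(\mathcal{D}_1)\cdot\epsilon_x(\mathcal{D}_2)$. 4. (Extraction) For all $x,y,z\in Q$ and $\mathcal{D}\in\Phi$ such that $x\vee z\,\bot\, y\vee z\,\vert\, z$ and $\epsilon_x(\mathcal{D})=\mathcal{D}$, we have $\epsilon_{y\vee z}(\mathcal{D})=\epsilon_{y\vee z}(\epsilon_z(\mathcal{D}))$. 5. (Support) For every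 $\mathcal{D}\in\Phi$ there is an $x\in Q$ with $\epsilon_x(\mathcal{D})=\mathcal{D}$ and such that $\epsilon_y(\mathcal{D})=\mathcal{D}$ for all $y\in Q$ with $y\geq x$.
   Context: Gambles. A gamble on a set $\Omega$ is a bounded function $f:\Omega\to\mathbb{R}$; $\mathcal{L}=\mathcal{L}(\Omega)$ is the set of all gambles and $\mathcal{L}^+=\mathcal{L}^+(\Omega):=\{f\in\mathcal{L}: f\geq 0, f\neq 0\}$. A set $\mathcal{D}\subseteq\mathcal{L}$ is coherent if (D1) $\mathcal{L}^+\subseteq\mathcal{D}$; (D2) the zero gamble is not in $\mathcal{D}$; (D3) $f,g\in\mathcal{D}$ implies $f+g\in\mathcal{D}$; (D4) $f\in\mathcal{D},\lambda>0$ implies $\lambda f\in\mathcal{D}$. $C(\Omega)$ is the family of coherent sets and $\Phi=\Phi(\Omega):=C(\Omega)\cup\{\mathcal{L}(\Omega)\}$. For $\mathcal{D}'\subseteq\mathcal{L}$, $\mathcal{C}(\mathcal{D}'):=\bigcap\{\mathcal{D}\in\Phi:\mathcal{D}'\subseteq\mathcal{D}\}$. Partitions and questions. $Part(\Omega)$ is the set of partitions of $\Omega$, ordered by: $\mathcal{P}\leq\mathcal{P}'$ iff every block of $\mathcal{P}'$ is contained in a block of $\mathcal{P}$ (finer is larger). The join $\mathcal{P}\vee\mathcal{P}'$ consists of the non-empty intersections of blocks of $\mathcal{P}$ with blocks of $\mathcal{P}'$. A family of partitions is indexed bijectively by $Q$ as $\{\mathcal{P}_x:x\in Q\}$; write $x\leq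 y$ iff $\mathcal{P}_x\leq\mathcal{P}_y$, and $x\vee y$ for the index with $\mathcal{P}_{x\vee y}=\mathcal{P}_x\vee\mathcal{P}_y$. The relation $x\bot y\vert z$ (conditional independence of $\mathcal{P}_x,\mathcal{P}_y$ given $\mathcal{P}_z$) means: for all blocks $B_1\in\mathcal{P}_x$, $B_2\in\mathcal{P}_y$, $B\in\mathcal{P}_z$ with $B_1\cap B\neq\emptyset$ and $B_2\cap B\neq\emptyset$, one has $B_1\cap B_2\cap B\neq\emptyset$. $\mathcal{L}_x$ is the set of gambles that are constant on every block of $\mathcal{P}_x$. Operations. For $\mathcal{D},\mathcal{D}_1,\mathcal{D}_2\in\Phi$ and $x\in Q$: combination $\mathcal{D}_1\cdot\mathcal{D}_2:=\mathcal{C}(\mathcal{D}_1\cup\mathcal{D}_2)$ and extraction $\epsilon_x(\mathcal{D}):=\mathcal{C}(\mathcal{D}\cap\mathcal{L}_x)$. A null element $0$ satisfies $\mathcal{D}\cdot 0=0$ for all $\mathcal{D}$, a unit $1$ satisfies $\mathcal{D}\cdot 1=\mathcal{D}$ for all $\mathcal{D}$. *)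

(* Defs.v *)
From mathcomp Require Import all_boot all_order all_algebra.
From mathcomp Require Import all_classical all_reals all_analysis.

Set Implicit Arguments.
Unset Strict Implicit.
Unset Printing Implicit Defensive.

Import Order.TTheory GRing.Theory Num.Theory.
Import numFieldNormedType.Exports.

Local Open Scope classical_set_scope.
Local Open Scope ring_scope.

Section Gambles.
Variables (R : realType) (Omega : Type).
Implicit Types (f g : Omega -> R) (D : set (Omega -> R)).

Definition gambles : set (Omega -> R) := [set f | bounded_fun f].

Definition pos_gambles : set (Omega -> R) :=
  [set f | [/\ gambles f, forall w, 0 <= f w & f <> cst 0]].

Record coherent D : Prop := Coherent {
  coherent_gambles : D `<=` gambles;
  coherent_pos : pos_gambles `<=` D;
  coherent_zero : ~ D (cst 0);
  coherent_add : forall f g, D f -> D g -> D (f \+ g);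
  coherent_scale : forall (lambda : R) f, D f -> 0 < lambda -> D (lambda \*o f)
}.

Definition Phi : set (set (Omega -> R)) :=
  [set D | coherent D] `|` [set gambles].

(* [smallest Phi D'] is the intersection of all members of Phi containing D';
   for D' included in [gambles], the family intersected contains [gambles]. *)
Definition closure_Phi (D' : set (Omega -> R)) : set (Omega -> R) :=
  smallest Phi D'.

Definition combine (D1 D2 : set (Omega -> R)) : set (Omega -> R) :=
  closure_Phi (D1 `|` D2).

Definition block_gambles (P : set (set Omega)) : set (Omega -> R) :=
  [set f | gambles f /\ forall B, P B -> forall u v, B u -> B v -> f u = f v].

Definition extract (P : set (set Omega)) D : set (Omega -> R) :=
  closure_Phi (D `&` block_gambles P).

End Gambles.

Arguments gambles R Omega : clear implicits.
Arguments pos_gambles R Omega : clear implicits.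
Arguments Phi R Omega : clear implicits.

Section Partitions.
Variable Omega : Type.
Implicit Types P : set (set Omega).

Definition is_partition P : Prop := partition P id [set: Omega].

Definition part_le P P' : Prop :=
  forall B', P' B' -> exists2 B, P B & B' `<=` B.

Definition part_join P P' : set (set Omega) :=
  [set C | C !=set0 /\ exists B B', [/\ P B, P' B' & C = B `&` B']].

Definition part_top : set (set Omega) := range (@set1 Omega).

Definition part_indep P1 P2 P : Prop :=
  forall B1 B2 B, P1 B1 -> P2 B2 -> P B ->
    B1 `&` B !=set0 -> B2 `&` B !=set0 -> B1 `&` B2 `&` B !=set0.

End Partitions.

Arguments part_top Omega : clear implicits.

Record join_semilattice (Q : Type) (le : Q -> Q -> Prop) (vee : Q -> Q -> Q)
    : Prop := JoinSemilattice {
  jsl_refl : forall x, le x x;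
  jsl_anti : forall x y, le x y -> le y x -> x = y;
  jsl_trans : forall x y z, le x y -> le y z -> le x z;
  jsl_ubl : forall x y, le x (vee x y);
  jsl_ubr : forall x y, le y (vee x y);
  jsl_lub : forall x y z, le x z -> le y z -> le (vee x y) z
}.

(* The carrier is the set [A]; [comb] and the [eps x] only matter on [A].
   [indep x y z] stands for x _|_ y | z. *)
Record domain_free_information_algebra (T : Type) (A : set T)
    (comb : T -> T -> T) (null unit : T)
    (Q : Type) (le : Q -> Q -> Prop) (vee : Q -> Q -> Q)
    (indep : Q -> Q -> Q -> Prop) (eps : Q -> T -> T)
    : Prop := DomainFreeInformationAlgebra {
  dfia_comb_closed : forall D1 D2, A D1 -> A D2 -> A (comb D1 D2);
  dfia_combA : forall D1 D2 D3, A D1 -> A D2 -> A D3 ->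
    comb D1 (comb D2 D3) = comb (comb D1 D2) D3;
  dfia_combC : forall D1 D2, A D1 -> A D2 -> comb D1 D2 = comb D2 D1;
  dfia_null_in : A null;
  dfia_comb_null : forall D, A D -> comb D null = null;
  dfia_unit_in : A unit;
  dfia_comb_unit : forall D, A D -> comb D unit = D;
  dfia_join : join_semilattice le vee;
  dfia_indep_self : forall x y, indep x y y;
  dfia_indep_sym : forall x y z, indep x y z -> indep y x z;
  dfia_indep_le : forall x y z w, indep x y z -> le w y -> indep x w z;
  dfia_indep_join : forall x y z, indep x y z -> indep x (vee y z) z;
  dfia_eps_closed : forall x D, A D -> A (eps x D);
  dfia_eps_null : forall x, eps x null = null;
  dfia_eps_comb : forall x D, A D -> comb (eps x D) D = D;
  dfia_eps_eps : forall x D1 D2, A D1 -> A D2 ->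
    eps x (comb (eps x D1) D2) = comb (eps x D1) (eps x D2);
  dfia_extraction : forall x y z D, A D ->
    indep (vee x z) (vee y z) z -> eps x D = D ->
    eps (vee y z) D = eps (vee y z) (eps z D);
  dfia_support : forall D, A D ->
    exists x, eps x D = D /\ forall y, le x y -> eps y D = D
}.

(* Main.v *)
Require Import Defs.
From mathcomp Require Import all_boot all_order all_algebra.
From mathcomp Require Import all_classical all_reals all_analysis.

Import Order.TTheory GRing.Theory Num.Theory.

Local Open Scope classical_set_scope.

(** The closure of a convex cone of gambles is its upward closure together with
    the positive gambles, unless that set contains 0, in which case the closure
    is the set of all gambles.  Both quantifier axioms reduce to this.  For
    eps_x(eps_x(D1).D2), an element f of L_x of the form e + d with d in D2 and
    e >= g in D1 `&` L_x is rewritten f = g + (f - g): now f - g is in L_x, and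
    it is in D2 because f - g >= d.  For the extraction axiom, g in D `&` L_x
    below f in L_(y v z) is replaced by its supremum over the blocks of P_z,
    which by conditional independence still lies below f. *)

(** * Partitions: order, join and conditional independence *)

Section Partitions.
Set Implicit Arguments.
Unset Strict Implicit.
Variable Omega : Type.
Implicit Types P : set (set Omega).

Lemma partition_block P w : is_partition P -> exists2 B, P B & B w.
Proof.
move=> [cov _ _]; have : cover P id w by rewrite cov.
by move=> [B PB Bw]; exists B.
Qed.

Lemma partition_eq P B B' w :
  is_partition P -> P B -> P B' -> B w -> B' w -> B = B'.
Proof. by move=> [_ tri _] PB PB' Bw B'w; apply: tri => //; exists w. Qed.

Lemma partition_nonempty P B : is_partition P -> P B -> B !=set0.
Proof. by move=> [_ _ ne]; exact: ne. Qed.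

Lemma part_le_refl P : part_le P P.
Proof. by move=> B PB; exists B. Qed.

Lemma part_le_trans P1 P2 P3 : part_le P1 P2 -> part_le P2 P3 -> part_le P1 P3.
Proof.
move=> le12 le23 B /le23[C /le12[D PD CD] BC]; exists D => //.
exact: subset_trans CD.
Qed.

(** Coarseness in both directions traps a block of [P2] between two blocks of [P1]; these share a
    point, hence coincide, and the block of [P2] equals both. *)
Lemma part_le_sub P1 P2 : is_partition P1 ->
  part_le P1 P2 -> part_le P2 P1 -> P1 `<=` P2.
Proof.
move=> p1 le12 le21 B PB; have [C PC BC] := le21 _ PB.
have [B' PB' CB'] := le12 _ PC; have [w Bw] := partition_nonempty p1 PB.
have BB' := partition_eq p1 PB PB' Bw (CB' _ (BC _ Bw)).
by rewrite (_ : B = C) //; apply/seteqP; split=> //; rewrite BB'.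
Qed.

Lemma part_le_anti P1 P2 : is_partition P1 -> is_partition P2 ->
  part_le P1 P2 -> part_le P2 P1 -> P1 = P2.
Proof. by move=> *; apply/seteqP; split; exact: part_le_sub. Qed.

Lemma part_joinl P1 P2 : part_le P1 (part_join P1 P2).
Proof. by move=> _ [_ [B [B' [PB PB' ->]]]]; exists B => // w []. Qed.

Lemma part_joinr P1 P2 : part_le P2 (part_join P1 P2).
Proof. by move=> _ [_ [B [B' [PB PB' ->]]]]; exists B' => // w []. Qed.

Lemma part_join_lub P1 P2 P : is_partition P ->
  part_le P1 P -> part_le P2 P -> part_le (part_join P1 P2) P.
Proof.
move=> p le1 le2 B PB; have [B1 PB1 BB1] := le1 _ PB; have [B2 PB2 BB2] := le2 _ PB.
have [w Bw] := partition_nonempty p PB.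
exists (B1 `&` B2); last by move=> u Bu; split; [exact: BB1|exact: BB2].
by split; [exists w; split; [exact: BB1|exact: BB2]|exists B1, B2].
Qed.

Lemma part_indep_self P1 P2 : is_partition P2 -> part_indep P1 P2 P2.
Proof.
move=> p2 B1 B2 B _ PB2 PB [w [B1w Bw]] [v [B2v Bv]].
by exists w; rewrite (partition_eq p2 PB2 PB B2v Bv).
Qed.

Lemma part_indep_sym P1 P2 P : part_indep P1 P2 P -> part_indep P2 P1 P.
Proof.
move=> ind B1 B2 B PB1 PB2 PB i1 i2.
by rewrite (setIC B1); exact: ind.
Qed.

(** Around a point common to the [P']-block and [B] there is a [P2]-block, contained in that
    [P']-block. Independence applied to this smaller block gives the required point. *)
Lemma part_indep_le P1 P2 P P' : is_partition P2 -> is_partition P' ->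
  part_indep P1 P2 P -> part_le P' P2 -> part_indep P1 P' P.
Proof.
move=> p2 p' ind le B1 B2 B PB1 PB2 PB i1 [w [B2w Bw]].
have [C PC Cw] := partition_block w p2; have [B' PB' CB'] := le _ PC.
have B'E := partition_eq p' PB' PB2 (CB' _ Cw) B2w.
have [|u [[B1u Cu] Bu]] := ind B1 C B PB1 PC PB i1; first by exists w.
by exists u; split=> //; split=> //; rewrite -B'E; exact: CB'.
Qed.

(** A block [B2] intersected with a [P]-block [B'] can meet [B] only if [B'] is [B], so the extra
    factor changes nothing inside [B]. *)
Lemma part_indep_join P1 P2 P : is_partition P ->
  part_indep P1 P2 P -> part_indep P1 (part_join P2 P) P.
Proof.
move=> p ind B1 _ B PB1 [_ [B2 [B' [PB2 PB' ->]]]] PB i1 [w [[B2w B'w] Bw]].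
have [|u [[B1u B2u] Bu]] := ind B1 B2 B PB1 PB2 PB i1; first by exists w.
by exists u; rewrite (partition_eq p PB' PB B'w Bw).
Qed.

End Partitions.

Section Gambles.
Local Open Scope ring_scope.
Set Implicit Arguments.
Unset Strict Implicit.
Variables (R : realType) (Omega : Type).
Implicit Types (f g h : Omega -> R) (D S : set (Omega -> R)).
Implicit Types (P : set (set Omega)).

(** * The space of gambles and the cone of positive gambles *)

Lemma gamblesP f : gambles R Omega f <-> exists M, forall w, `|f w| <= M.
Proof.
have -> : gambles R Omega f = bounded_near (f : Omega -> R^o) (globally setT) by [].
rewrite /bounded_near; split.
  (* The library notion only says that every number strictly above [M] is a bound, hence the
     [+ 1]. *)
  move=> [M [_ fM]]; exists (M + 1) => w.
  by apply: fM => //; rewrite ltrDl ltr01.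
move=> [M fM]; exists M; split; first exact: num_real.
by move=> N MN w _ /=; exact: le_trans (fM w) (ltW MN).
Qed.

Lemma gamblesD f g :
  gambles R Omega f -> gambles R Omega g -> gambles R Omega (f \+ g).
Proof.
move=> /gamblesP[M fM] /gamblesP[N gN]; apply/gamblesP; exists (M + N) => w /=.
exact: le_trans (ler_normD _ _) (lerD (fM w) (gN w)).
Qed.

Lemma gamblesZ (a : R) f : gambles R Omega f -> gambles R Omega (a \*o f).
Proof.
move=> /gamblesP[M fM]; apply/gamblesP; exists (`|a| * M) => w /=.
by rewrite normrM ler_wpM2l.
Qed.

Lemma gamblesB f g :
  gambles R Omega f -> gambles R Omega g -> gambles R Omega (f \- g).
Proof.
move=> /gamblesP[M fM] /gamblesP[N gN]; apply/gamblesP; exists (M + N) => w /=.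
exact: le_trans (ler_normB _ _) (lerD (fM w) (gN w)).
Qed.

Lemma gambles0 : gambles R Omega (cst 0).
Proof. by apply/gamblesP; exists 0 => w /=; rewrite normr0. Qed.

Lemma sub_pos_gambles : pos_gambles R Omega `<=` gambles R Omega.
Proof. by move=> f []. Qed.

Lemma pos_gamblesD f g :
  pos_gambles R Omega f -> pos_gambles R Omega g -> pos_gambles R Omega (f \+ g).
Proof.
move=> [bf f0 fN0] [bg g0 _]; split; [exact: gamblesD|by move=> w /=; apply: addr_ge0|].
move=> fg0; apply: fN0; apply/funext => w /=; apply/eqP; rewrite eq_le f0 andbT.
have <- : (f \+ g) w = 0 by rewrite fg0.
by rewrite /= lerDl.
Qed.

Lemma pos_gamblesZ (a : R) f :
  pos_gambles R Omega f -> 0 < a -> pos_gambles R Omega (a \*o f).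
Proof.
move=> [bf f0 fN0] a0; split; first exact: gamblesZ.
  by move=> w /=; rewrite mulr_ge0 // ltW.
move=> af0; apply: fN0; apply/funext => w /=.
have /eqP : (a \*o f) w = 0 by rewrite af0.
by rewrite /= mulf_eq0 gt_eqF //= => /eqP.
Qed.

Lemma coherent_pos_gambles : coherent (pos_gambles R Omega).
Proof.
split=> //; first exact: sub_pos_gambles.
- by case.
- exact: pos_gamblesD.
- exact: pos_gamblesZ.
Qed.

Lemma addf_subK f g : f = g \+ (f \- g).
Proof. by apply/funext => w /=; rewrite addrC subrK. Qed.

(** * Properties shared by coherent sets and the set of all gambles *)

Lemma Phi_gambles D : Phi R Omega D -> D `<=` gambles R Omega.
Proof. by move=> [/coherent_gambles|->]. Qed.

Lemma Phi_pos D : Phi R Omega D -> pos_gambles R Omega `<=` D.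
Proof. by move=> [/coherent_pos//|->]; exact: sub_pos_gambles. Qed.

Lemma Phi_add D f g : Phi R Omega D -> D f -> D g -> D (f \+ g).
Proof. by move=> [/coherent_add|->]; [apply|exact: gamblesD]. Qed.

Lemma Phi_scale D (a : R) f : Phi R Omega D -> D f -> 0 < a -> D (a \*o f).
Proof. by move=> [/coherent_scale|-> Df _]; [apply|exact: gamblesZ]. Qed.

Lemma Phi0 D : Phi R Omega D -> D (cst 0) -> D = gambles R Omega.
Proof. by move=> [/coherent_zero|]. Qed.

(** If [f] differs from [g], then [f - g] is a positive gamble, so (D1) and (D3) apply to
    [g + (f - g)]. *)
Lemma Phi_up D f g : Phi R Omega D -> D g -> gambles R Omega f ->
  (forall w, g w <= f w) -> D f.
Proof.
move=> PD Dg bf gf; have [<-//|neq] := pselect (g = f).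
rewrite (addf_subK f g); apply: Phi_add => //; apply: (Phi_pos PD); split.
- by apply: gamblesB => //; exact: Phi_gambles Dg.
- by move=> w /=; rewrite subr_ge0.
- move=> fg; apply: neq; apply/funext => w; apply/esym/eqP; rewrite -subr_eq0.
  by rewrite -[f w - g w]/((f \- g) w) fg.
Qed.

Lemma Phi_null : Phi R Omega (gambles R Omega).
Proof. by right. Qed.

Lemma Phi_unit : Phi R Omega (pos_gambles R Omega).
Proof. by left; exact: coherent_pos_gambles. Qed.

(** * The closure operator and its description on cones *)

Lemma sub_closure S : S `<=` closure_Phi S.
Proof. exact: sub_gen_smallest. Qed.

Lemma closure_sub S D : Phi R Omega D -> S `<=` D -> closure_Phi S `<=` D.
Proof. exact: smallest_sub. Qed.

Lemma closure_id D : Phi R Omega D -> closure_Phi D = D.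
Proof. exact: smallest_id. Qed.

(** If the closure contains 0, every member of [Phi] above [S] contains 0 and is therefore the set
    of all gambles. Otherwise the intersection inherits the remaining coherence conditions. *)
Lemma Phi_closure S : S `<=` gambles R Omega -> Phi R Omega (closure_Phi S).
Proof.
move=> bS; have clb : closure_Phi S `<=` gambles R Omega.
  exact: closure_sub Phi_null bS.
have [cl0|clN0] := pselect (closure_Phi S (cst 0)).
  right; apply/seteqP; split=> // f bf D [PD SD].
  by rewrite (Phi0 PD) //; exact: cl0.
left; split=> //.
- by move=> f pf D [PD _]; exact: Phi_pos pf.
- by move=> f g Sf Sg D [PD SD]; apply: Phi_add => //; [exact: Sf|exact: Sg].
- by move=> a f Sf a0 D [PD SD]; apply: Phi_scale => //; exact: Sf.
Qed.

Lemma sub_closure2 S S' :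
  S' `<=` gambles R Omega -> S `<=` S' -> closure_Phi S `<=` closure_Phi S'.
Proof. by move=> bS'; apply: sub_smallest2r; exact: Phi_closure. Qed.

(** The positive gambles are joined explicitly because they need not dominate an element of [S], for
    instance when [S] is empty. *)
Definition upward S : set (Omega -> R) := pos_gambles R Omega `|`
  [set f | gambles R Omega f /\ exists2 g, S g & forall w, g w <= f w].

(** Under these hypotheses [upward S] is itself coherent and contains [S]; only this inclusion of
    the closure is needed below. *)
Lemma closure_cone S : S `<=` gambles R Omega ->
  (forall f g, S f -> S g -> S (f \+ g)) ->
  (forall (a : R) f, S f -> 0 < a -> S (a \*o f)) ->
  ~ upward S (cst 0) -> closure_Phi S `<=` upward S.
Proof.
move=> bS SD SZ S0; apply: closure_sub; last first.
  by move=> f Sf; right; split; [exact: bS|exists f].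
left; split=> //.
- by move=> f [/sub_pos_gambles//|[]].
- by move=> f pf; left.
- move=> f g [pf|[bf [f' Sf' f'f]]] [pg|[bg [g' Sg' g'g]]].
  + by left; exact: pos_gamblesD.
  + right; split; first exact: gamblesD (sub_pos_gambles pf) bg.
    by exists g' => // w /=; case: pf => _ f0 _; rewrite -[g' w]add0r lerD.
  + right; split; first exact: gamblesD bf (sub_pos_gambles pg).
    by exists f' => // w /=; case: pg => _ g0 _; rewrite -[f' w]addr0 lerD.
  + right; split; first exact: gamblesD.
    by exists (f' \+ g'); [exact: SD|move=> w /=; exact: lerD].
- move=> a f [pf|[bf [f' Sf' f'f]]] a0; first by left; exact: pos_gamblesZ.
  right; split; first exact: gamblesZ.
  by exists (a \*o f'); [exact: SZ|move=> w /=; rewrite ler_pM2l].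
Qed.

(** * Combination *)

Lemma setU_gambles D1 D2 : Phi R Omega D1 -> Phi R Omega D2 ->
  D1 `|` D2 `<=` gambles R Omega.
Proof. by move=> P1 P2 f [/(Phi_gambles P1)|/(Phi_gambles P2)]. Qed.

Lemma Phi_combine D1 D2 : Phi R Omega D1 -> Phi R Omega D2 ->
  Phi R Omega (combine D1 D2).
Proof. by move=> P1 P2; apply: Phi_closure; exact: setU_gambles. Qed.

Lemma combineC D1 D2 : combine D1 D2 = combine D2 D1.
Proof. by rewrite /combine setUC. Qed.

Lemma sub_combinel D1 D2 : D1 `<=` combine D1 D2.
Proof. by move=> f D1f; apply: sub_closure; left. Qed.

Lemma sub_combiner D1 D2 : D2 `<=` combine D1 D2.
Proof. by move=> f D1f; apply: sub_closure; right. Qed.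

Lemma combine_sub D1 D2 D : Phi R Omega D -> D1 `<=` D -> D2 `<=` D ->
  combine D1 D2 `<=` D.
Proof. by move=> PD D1D D2D; apply: closure_sub => // f [/D1D|/D2D]. Qed.

Lemma combine_idl D1 D2 : Phi R Omega D2 -> D1 `<=` D2 -> combine D1 D2 = D2.
Proof. by move=> P2 D12; rewrite /combine (proj2 (setUidPr _ _) D12) closure_id. Qed.

Lemma combineA D1 D2 D3 : Phi R Omega D1 -> Phi R Omega D2 -> Phi R Omega D3 ->
  combine D1 (combine D2 D3) = combine (combine D1 D2) D3.
Proof.
move=> P1 P2 P3; have P12 := Phi_combine P1 P2.
have P23 := Phi_combine P2 P3.
apply/seteqP; split; apply: combine_sub; try exact: Phi_combine.
- apply: (subset_trans (@sub_combinel D1 D2)); exact: sub_combinel.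
- apply: combine_sub; [exact: Phi_combine| |exact: sub_combiner].
  apply: (subset_trans (@sub_combiner D1 D2)); exact: sub_combinel.
- apply: combine_sub; [exact: Phi_combine|exact: sub_combinel|].
  apply: (subset_trans (@sub_combinel D2 D3)); exact: sub_combiner.
- apply: (subset_trans (@sub_combiner D2 D3)); exact: sub_combiner.
Qed.

(** [K] is a cone that is already closed upwards, so it absorbs the closure as long as it avoids 0.
    When it contains 0 nothing is claimed about [f], and callers treat that case separately. *)
Lemma combine_sum D1 D2 f : Phi R Omega D1 -> Phi R Omega D2 ->
  let K := D1 `|` D2 `|` [set d | exists d1 d2, [/\ D1 d1, D2 d2 & d = d1 \+ d2]] in
  combine D1 D2 f -> K (cst 0) \/ K f.
Proof.
move=> P1 P2 K Cf; have [K0|K0] := pselect (K (cst 0)); [by left|right].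
have bK : K `<=` gambles R Omega.
  move=> f1 [/(setU_gambles P1 P2)//|[d1 [d2 [D1d1 D2d2 ->]]]].
  by apply: gamblesD; [exact: (Phi_gambles P1)|exact: (Phi_gambles P2)].
have upK : upward K `<=` K.
  move=> g [pg|[bg [h Kh hg]]]; first by left; left; exact: (Phi_pos P1).
  case: Kh hg => [[Dh|Dh] hg|[d1 [d2 [D1d1 D2d2 ->]]] hg].
  - by left; left; exact: (Phi_up P1 Dh).
  - by left; right; exact: (Phi_up P2 Dh).
  (* The whole excess of [g] over [d1 + d2] is put into the second summand, which stays in [D2]
     because it dominates [d2]. *)
  - right; exists d1, (g \- d1); split => //; last exact: addf_subK.
    apply: (Phi_up P2 D2d2); first by apply: gamblesB => //; exact: (Phi_gambles P1).
    by move=> w /=; rewrite lerBrDl; exact: hg.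
have Ksum d1 d2 : D1 d1 -> D2 d2 -> K (d1 \+ d2).
  by move=> ? ?; right; exists d1, d2.
have KC : closure_Phi K `<=` upward K.
  apply: closure_cone => //; last by move=> /upK.
  - have swap a b : a \+ b = b \+ a :> (Omega -> R).
      by apply/funext => w /=; rewrite addrC.
    have assoc a b c : (a \+ b) \+ c = a \+ (b \+ c) :> (Omega -> R).
      by apply/funext => w /=; rewrite addrA.
    have addl a b c : a \+ (b \+ c) = b \+ (a \+ c) :> (Omega -> R).
      by apply/funext => w /=; rewrite addrCA.
    have D1add := fun a b => Phi_add (f := a) (g := b) P1.
    have D2add := fun a b => Phi_add (f := a) (g := b) P2.
    (* In each of the nine cases the terms are regrouped into a part from [D1] and a part from
       [D2]. *)
    move=> f1 f2 [[a1|a2]|[a [a' [a1 a2 ->]]]] [[b1|b2]|[b [b' [b1 b2 ->]]]].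
    + by left; left; apply: D1add.
    + exact: Ksum.
    + by rewrite -assoc; apply: Ksum => //; apply: D1add.
    + by rewrite swap; exact: Ksum.
    + by left; right; apply: D2add.
    + by rewrite addl; apply: Ksum => //; apply: D2add.
    + by rewrite swap -assoc; apply: Ksum => //; apply: D1add.
    + by rewrite assoc; apply: Ksum => //; apply: D2add.
    + by rewrite assoc (addl a') -assoc; apply: Ksum; [apply: D1add|apply: D2add].
  - move=> a f1 [[d1|d2]|[d [d' [d1 d2 ->]]]] a0.
    + by left; left; exact: Phi_scale.
    + by left; right; exact: Phi_scale.
    + have -> : a \*o (d \+ d') = (a \*o d) \+ (a \*o d').
        by apply/funext => w /=; rewrite mulrDr.
      by apply: Ksum; exact: Phi_scale.
by apply/upK/KC; apply: sub_closure2 Cf => // g Dg; left.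
Qed.

(** * Extraction *)

Lemma sub_extract P D : D `&` block_gambles P `<=` extract P D.
Proof. exact: sub_closure. Qed.

Lemma setI_block_gambles P D : D `&` block_gambles P `<=` gambles R Omega.
Proof. by move=> f [_ []]. Qed.

Lemma Phi_extract P D : Phi R Omega (extract P D).
Proof. by apply: Phi_closure; exact: setI_block_gambles. Qed.

Lemma sub_extract2 P D D' : D `<=` D' -> extract P D `<=` extract P D'.
Proof.
move=> DD'; apply: sub_closure2; first exact: setI_block_gambles.
by move=> f [/DD'].
Qed.

Lemma extract_sub P D : Phi R Omega D -> extract P D `<=` D.
Proof. by move=> PD; apply: closure_sub => // f []. Qed.

Lemma block_gambles0 P : block_gambles P (cst 0 : Omega -> R).
Proof. by split=> //; exact: gambles0. Qed.

Lemma block_gamblesD P f g :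
  block_gambles P f -> block_gambles P g -> block_gambles P (f \+ g).
Proof.
move=> [bf fP] [bg gP]; split; first exact: gamblesD.
by move=> B PB u v Bu Bv /=; rewrite (fP B PB u v) // (gP B PB u v).
Qed.

Lemma block_gamblesZ P (a : R) f : block_gambles P f -> block_gambles P (a \*o f).
Proof.
move=> [bf fP]; split; first exact: gamblesZ.
by move=> B PB u v Bu Bv /=; rewrite (fP B PB u v).
Qed.

Lemma block_gamblesB P f g :
  block_gambles P f -> block_gambles P g -> block_gambles P (f \- g).
Proof.
move=> [bf fP] [bg gP]; split; first exact: gamblesB.
by move=> B PB u v Bu Bv /=; rewrite (fP B PB u v) // (gP B PB u v).
Qed.

(** The zero gamble is constant on every block, so it survives the intersection, and no coherent set
    contains it. *)
Lemma extract_null P : extract P (gambles R Omega) = gambles R Omega.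
Proof.
apply: Phi0; first exact: Phi_extract.
by apply: sub_extract; split; [exact: gambles0|exact: block_gambles0].
Qed.

Lemma extract_id P D : Phi R Omega D ->
  gambles R Omega `<=` block_gambles P -> extract P D = D.
Proof.
move=> PD bP; rewrite /extract (proj2 (setIidPl _ _)) ?closure_id //.
exact: subset_trans (Phi_gambles PD) bP.
Qed.

(** Coherence rules out the degenerate case: an element of [D] below 0 would put 0 itself into
    [D]. *)
Lemma extract_upward P D : coherent D -> extract P D `<=` upward (D `&` block_gambles P).
Proof.
move=> cD; have PD : Phi R Omega D by left.
apply: closure_cone; first exact: setI_block_gambles.
- move=> f g [Df Pf] [Dg Pg]; split; first exact: Phi_add.
  exact: block_gamblesD.
- move=> a f [Df Pf] a0; split; first exact: Phi_scale.
  exact: block_gamblesZ.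
- move=> [[]//|[_ [g [Dg _] g0]]]; apply: (coherent_zero cD).
  exact: (Phi_up PD Dg gambles0).
Qed.

Lemma extract_combine P D1 D2 : Phi R Omega D1 -> Phi R Omega D2 ->
  extract P (combine (extract P D1) D2) = combine (extract P D1) (extract P D2).
Proof.
move=> P1 P2; have PE1 := Phi_extract P D1; have PE2 := Phi_extract P D2.
have PR := Phi_combine PE1 PE2.
apply/seteqP; split; last first.
  apply: combine_sub; first exact: Phi_extract.
    apply: closure_sub; first exact: Phi_extract.
    move=> f [Df Pf]; apply: sub_extract; split => //.
    by apply: sub_combinel; apply: sub_extract.
  by apply: sub_extract2; exact: sub_combiner.
(* If [D1] is the null element, both sides collapse to it. *)
case: P1 => [c1|->]; last first.
  rewrite extract_null !(combineC (gambles _ _)).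
  rewrite !(combine_idl Phi_null); [|exact: Phi_gambles..].
  by rewrite extract_null.
(* Stating the claim for every block-constant [f] also settles the degenerate alternative of
   [combine_sum]: applied to 0, it puts 0 into the right-hand side, which is then the set of all
   gambles. *)
suff H f : block_gambles P f ->
    (extract P D1 `|` D2 `|` [set d | exists d1 d2,
      [/\ extract P D1 d1, D2 d2 & d = d1 \+ d2]]) f ->
    combine (extract P D1) (extract P D2) f.
  apply: closure_sub => // f [/combine_sum Kf Pf].
  have [K0|] := Kf PE1 P2; last exact: H.
  by rewrite (Phi0 PR (H _ (block_gambles0 P) K0)); exact: (proj1 Pf).
have D2R : D2 `&` block_gambles P `<=` combine (extract P D1) (extract P D2).
  by move=> g D2g; apply: sub_combiner; exact: sub_extract.
move=> Pf [[|D2f]|[d1 [d2 [E1 D2d2 fE]]]]; first exact: sub_combinel.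
  exact: D2R.
have [pd1|[_ [g [D1g Pg] gd1]]] := extract_upward c1 E1.
  by apply: D2R; split=> //; rewrite fE; apply: Phi_add => //; exact: (Phi_pos P2).
rewrite (addf_subK f g); apply: (Phi_add PR) => //.
  by apply: sub_combinel; exact: sub_extract.
have Pfg := block_gamblesB Pf Pg.
apply: D2R; split=> //; apply: (Phi_up P2 D2d2 (proj1 Pfg)) => w.
by rewrite fE /= addrAC lerDr subr_ge0.
Qed.

Lemma extract_indep (Px Pz Pxz Pyz : set (set Omega)) D :
  is_partition Pz -> is_partition Pxz -> is_partition Pyz ->
  part_le Px Pxz -> part_indep Pxz Pyz Pz -> Phi R Omega D -> extract Px D = D ->
  extract Pyz D = extract Pyz (extract Pz D).
Proof.
move=> pz pxz pyz lex ind PD xD.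
apply/seteqP; split; last by apply: sub_extract2; exact: extract_sub.
case: PD => [cD|->]; last by rewrite !extract_null.
have PD : Phi R Omega D by left.
apply: closure_sub; first exact: Phi_extract.
move=> f [Df Pf]; apply: sub_extract; split => //.
have PE := Phi_extract Pz D.
(* Since [D] is supported by [Px], [f] is either positive, hence in every member of [Phi], or above
   some [g] in [D] that is constant on the blocks of [Px]. *)
move: Df; rewrite -{1}xD => /(extract_upward cD) [/(Phi_pos PE)//|[bf [g [Dg [bg gx]] gf]]].
pose A w := [set r | exists B v, [/\ Pz B, B w, B v & r = g v]].
(* [A w] collects the values of [g] on the [Pz]-block of [w]. It is non-empty and bounded, so [sup]
   is a true supremum and not a default value. *)
pose h w := sup (A w).
have A0 w : A w !=set0.
  by have [B PB Bw] := partition_block w pz; exists (g w), B, w.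
have [M gM] := proj1 (gamblesP g) bg.
have Aub w : has_ubound (A w).
  exists M => _ [B [v [_ _ _ ->]]]; exact: le_trans (ler_norm _) (gM v).
have gh w : g w <= h w.
  by apply: ub_le_sup => //; have [B PB Bw] := partition_block w pz; exists B, w.
have bh : gambles R Omega h.
  apply/gamblesP; exists M => w; rewrite ler_norml; apply/andP; split.
    by apply: le_trans (gh w); move: (gM w); rewrite ler_norml => /andP[].
  by apply: ge_sup => // _ [B [v [_ _ _ ->]]]; exact: le_trans (ler_norm _) (gM v).
have hz : block_gambles Pz h.
  split=> // B PB u v Bu Bv; rewrite /h; congr sup.
  apply/seteqP; split=> _ [C [t [PC Cw Ct ->]]]; exists B, t; split=> //.
    by rewrite (partition_eq pz PB PC Bu Cw).
  by rewrite (partition_eq pz PB PC Bv Cw).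
have hf w : h w <= f w.
  apply: ge_sup => // _ [B [v [PB Bw Bv ->]]].
  (* Independence links [v] and [w], which share a [Pz]-block, through a point [u] in both [B1] and
     [B2]: [g v = g u <= f u = f w]. *)
  have [B1 PB1 B1v] := partition_block v pxz; have [B2 PB2 B2w] := partition_block w pyz.
  have [||u [[B1u B2u] Bu]] := ind B1 B2 B PB1 PB2 PB; first by exists v.
    by exists w.
  have [C PC B1C] := lex _ PB1.
  rewrite (gx C PC v u) ?(proj2 Pf B2 PB2 w u) //; exact: B1C.
apply: (Phi_up PE _ bf hf); apply: sub_extract; split => //.
exact: (Phi_up PD Dg bh gh).
Qed.

(** Every block lies in a singleton, so constancy on blocks is vacuous. This makes the top index a
    support of every element of [Phi]. *)
Lemma block_gambles_fine P :
  part_le (part_top Omega) P -> gambles R Omega `<=` block_gambles P.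
Proof.
move=> le f bf; split=> // B PB u v Bu Bv.
by have [_ [w _ <-] Bw] := le _ PB; rewrite (Bw _ Bu) (Bw _ Bv).
Qed.

End Gambles.

Theorem mainTheorem1 (R : realType) (Omega Q : Type)
    (P : Q -> set (set Omega)) (vee : Q -> Q -> Q)
    (P_partition : forall x : Q, is_partition (P x))
    (P_inj : forall x y : Q, P x = P y -> x = y)
    (P_vee : forall x y : Q, P (vee x y) = part_join (P x) (P y))
    (P_top : exists top : Q, P top = part_top Omega) :
  domain_free_information_algebra
    (Phi R Omega)
    (@combine R Omega) (gambles R Omega) (pos_gambles R Omega)
    (fun x y : Q => part_le (P x) (P y)) vee
    (fun x y z : Q => part_indep (P x) (P y) (P z))
    (fun x : Q => extract (P x)).
Proof.
split.
- exact: Phi_combine.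
- exact: combineA.
- by move=> D1 D2 _ _; exact: combineC.
- exact: Phi_null.
- by move=> D PD; apply: combine_idl; [exact: Phi_null|exact: Phi_gambles].
- exact: Phi_unit.
- by move=> D PD; rewrite combineC; apply: combine_idl => //; exact: Phi_pos.
- split.
  + by move=> x; exact: part_le_refl.
  + by move=> x y xy yx; apply: P_inj; exact: part_le_anti.
  + by move=> x y z; exact: part_le_trans.
  + by move=> x y; rewrite P_vee; exact: part_joinl.
  + by move=> x y; rewrite P_vee; exact: part_joinr.
  + by move=> x y z; rewrite P_vee; exact: part_join_lub.
- by move=> x y; exact: part_indep_self.
- by move=> x y z; exact: part_indep_sym.
- by move=> x y z w; exact: part_indep_le.
- by move=> x y z; rewrite P_vee; exact: part_indep_join.
- by move=> x D _; exact: Phi_extract.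
- by move=> x; exact: extract_null.
- by move=> x D PD; apply: combine_idl => //; exact: extract_sub.
- by move=> x D1 D2; exact: extract_combine.
- move=> x y z D PD ind xD.
  apply: (extract_indep _ _ _ _ ind PD xD) => //.
  by rewrite P_vee; exact: part_joinl.
- move=> D PD; have [top topE] := P_top.
  have eps_id y : part_le (P top) (P y) -> extract (P y) D = D.
    by rewrite topE => le; apply: extract_id => //; exact: block_gambles_fine.
  by exists top; split=> //; apply: eps_id; exact: part_le_refl.
Qed.
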